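(* Choose any decay factor $\alpha\in(0,1)$, failure probability $p\in(0,1)$, error parameter $c\in(0,\tfrac12]$, and any functions $\delta(n)\in(0,1)$ and $m(n)\in\Omega(n)\cap O(n^2)$. Consider any (possibly randomized) algorithm in the arc-centric graph query model which, for an arbitrary directed graph $G$ with $O(m)$ edges and $O(n)$ nodes and any target node $t$ of $G$, with probability at least $1-p$ outputs an estimate $\hat\pi(\cdot,t)$ of the single-target PPR vector $\pi(\cdot,t)$ satisfying $|\hat\pi(v,t)-\pi(v,t)|\le c\cdot\pi(v,t)$ for each node $v$ with $\pi(v,t)\ge\delta$. Then there exist a graph $\mathrm U$ and a target node $t$ such that (i) $\mathrm U$ contains $O(m)$ edges and $O(n)$ nodes; (ii) the algorithm requires $\Omega\!\left(\min\left(m,\frac{n}{\delta}\cdot\log(n)\right)\right)$ queries to succeed in the worst case.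
   Context: Graphs are directed, without parallel edges (self-loops allowed). Personalized PageRank (PPR): for a decay factor $\alpha\in(0,1)$, an $\alpha$-decay random walk from $v$ at each step stops at the current node with probability $\alpha$, and with probability $1-\alpha$ moves to a uniformly random out-neighbour of the current node. $\pi(v,t)$ is the probability that the walk started at $v$ terminates at $t$. It is assumed, without loss of generality, that graphs have no dangling nodes (nodes without out-neighbours). The parameters $\alpha,p,c$ are treated as constants in the asymptotic notation. Arc-centric graph query model: nodes carry labels in $\{1,\dots,|V|\}$; the out-edges (in-edges) of a node $v$ are indexed by $1,\dots,d_{out}(v)$ (resp. $1,\dots,d_{in}(v)$); a graph instance includes these labels. The algorithm is given $t$ (which is covered) and accesses $G$ only via unit-cost queries: JUMP() returns a uniformly random node and marks it covered; INDEG$(v)$/OUTDEG$(v)$ return the in-/out-degree of a covered node $v$; ADJ$_{in}(v,i)$/ADJ$_{out}(v,i)$ return the $i$-th in-/out-neighbour of a covered node $v$ (which then becomes covered).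
   Formalization: The bound is proved for n with δ(n) ≤ δ₀, where δ₀>0 depends only on α, p, c; for arbitrary δ(n)∈(0,1) the claim fails: with c=1/2, δ=1/3, returning the constant 1/2 for every node is always accurate and needs no queries. *)

(* Defs.v *)
From HB Require Import structures.
From mathcomp Require Import all_boot all_order all_algebra.
From mathcomp Require Import all_classical all_reals all_analysis.

Set Implicit Arguments.
Unset Strict Implicit.
Unset Printing Implicit Defensive.

Import Order.TTheory GRing.Theory Num.Theory.
Import numFieldNormedType.Exports.

Local Open Scope classical_set_scope.
Local Open Scope ring_scope.

(* A graph instance: the out-edges (in-edges) of v are numbered by their
   position in the adjacency list outs v (ins v). The lists are duplicate-free
   since there are no parallel edges; self-loops are allowed. Labels and edge
   indices start at 0 rather than 1. *)
Record graph := Graph {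
  nnodes : nat;
  outs : 'I_nnodes -> seq 'I_nnodes;
  ins : 'I_nnodes -> seq 'I_nnodes;
  outs_uniq : forall v, uniq (outs v);
  ins_uniq : forall v, uniq (ins v);
  outs_ins : forall u v, (v \in outs u) = (u \in ins v);
  no_dangling : forall v, outs v != [::] }.

Definition nedges (G : graph) : nat := (\sum_(v < nnodes G) size (outs v))%N.

Section PageRank.
Variables (R : realType) (alpha : R) (G : graph) (t : 'I_(nnodes G)).

(* The probability that the alpha-decay walk from v moves exactly k times and
   then stops, at t; obtained by conditioning on the first move. *)
Fixpoint stop_prob (k : nat) (v : 'I_(nnodes G)) : R :=
  if k is k'.+1 then
    (1 - alpha) * ((\sum_(w <- outs v) stop_prob k' w) / (size (outs v))%:R)
  else alpha * (v == t)%:R.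

Definition ppr (v : 'I_(nnodes G)) : R := limn (series (stop_prob^~ v)).

Definition accurate (c delta : R) (est : nat -> R) : bool :=
  [forall v : 'I_(nnodes G),
     (delta <= ppr v) ==> (`|est v - ppr v| <= c * ppr v)].

End PageRank.

Inductive query :=
  | Jump
  | Indeg of nat
  | Outdeg of nat
  | AdjIn of nat & nat
  | AdjOut of nat & nat.

(* Illegal answers a query about an uncovered node, or with an edge index that
   is out of range. *)
Inductive answer :=
  | Node of nat
  | Degree of nat
  | Illegal.

Inductive action (R : Type) :=
  | Ask of query
  | Return of nat -> R.

Section Model.
Variable G : graph.

Definition at_covered (cov : {set 'I_(nnodes G)}) (x : nat)
    (F : 'I_(nnodes G) -> answer * {set 'I_(nnodes G)}) :=
  if [pick v in cov | val v == x] is Some v then F v else (Illegal, cov).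

Definition neighbour (cov : {set 'I_(nnodes G)}) (s : seq 'I_(nnodes G))
    (i : nat) :=
  if onth s i is Some w then (Node w, w |: cov)%SET else (Illegal, cov).

(* The equally likely outcomes of a query when the nodes in cov are covered:
   the answer, together with the set of nodes covered afterwards. *)
Definition outcomes (cov : {set 'I_(nnodes G)}) (q : query) :
    seq (answer * {set 'I_(nnodes G)}) :=
  match q with
  | Jump => [seq (Node v, v |: cov)%SET | v : 'I_(nnodes G)]
  | Indeg x => [:: at_covered cov x (fun v => (Degree (size (ins v)), cov))]
  | Outdeg x => [:: at_covered cov x (fun v => (Degree (size (outs v)), cov))]
  | AdjIn x i => [:: at_covered cov x (fun v => neighbour cov (ins v) i)]
  | AdjOut x i => [:: at_covered cov x (fun v => neighbour cov (outs v) i)]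
  end.

(* The probability, over the JUMPs, that a strategy with fixed internal coins
   returns an estimate satisfying ok after at most q further queries, if h is
   the list of answers received so far. *)
Fixpoint success_from (R : realType) (strategy : seq answer -> action R)
    (ok : (nat -> R) -> bool) (q : nat) (cov : {set 'I_(nnodes G)})
    (h : seq answer) : R :=
  match strategy h with
  | Return est => (ok est)%:R
  | Ask a =>
    if q is q'.+1 then
      (\sum_(r <- outcomes cov a)
         success_from strategy ok q' r.2 (rcons h r.1))
      / (size (outcomes cov a))%:R
    else 0
  end.

End Model.

(* A randomized algorithm draws its internal coins from an arbitrary
   probability space; given the coins and the label of the target node, the
   next action depends on the answers received so far. There is no
   computability or running time restriction. *)
Record algorithm (R : realType) := Algorithm {
  coins_display : measure_display;
  coins : measurableType coins_display;
  coin_law : probability coins R;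
  step : nat -> coins -> seq answer -> action R;
  measurable_ask : forall t h a, measurable [set w | step t w h = Ask R a];
  measurable_return : forall t h x (B : set R), measurable B ->
    measurable [set w | exists2 est, step t w h = Return est & B (est x)] }.

Section Success.
Variables (R : realType) (alpha c delta : R) (A : algorithm R).
Variables (G : graph) (t : 'I_(nnodes G)).

Definition success_within (q : nat) : \bar R :=
  (\int[coin_law A]_w
     (success_from (step t w) (accurate alpha t c delta) q [set t]%SET
        [::])%:E)%E.

(* success_within is nondecreasing in q, so the supremum is the probability of
   ever returning an accurate estimate; runs that never return are failures. *)
Definition success_prob : \bar R := ereal_sup (range success_within).

End Success.

(* Main.v *)
Require Import Defs.
From HB Require Import structures.
From mathcomp Require Import all_boot all_order all_algebra.
From mathcomp Require Import all_classical all_reals all_analysis.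
From mathcomp Require Import zify ring lra.

Set Implicit Arguments.
Unset Strict Implicit.
Unset Printing Implicit Defensive.

Import Order.TTheory GRing.Theory Num.Theory.
Import numFieldNormedType.Exports HBNNSimple.

Local Open Scope ring_scope.

(* Take rows I and columns J and, for every pair (i, j), a hidden bit saying
   whether row i hits column j. In the graph built from these bits, the PageRank
   of row i with respect to t is (1 - alpha)^2 times the fraction of columns it
   hits, degrees carry no information, and a query reveals at most one bit.
   Every row hits a fixed set B of k columns; with prior probability 1/2 it is
   "heavy" and hits h = 2k + 1 further columns, uniformly random among the 4r
   others, which multiplies its PageRank by more than 3 >= (1 + c) / (1 - c).
   A row examined at most r times still hides all its extra hits with
   probability at least 2^-h, so that the algorithm errs on that row with
   probability of order at least 2^-h. Since the rows are independent, of the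
   order of n r queries are needed unless n 2^-h is bounded. Taking r of the
   order of min(m / n, ln n / delta) with a small constant keeps k of the order
   of delta r + 1 and n 2^-h of order at least sqrt n.
   The bookkeeping is done by a potential, a product over the rows, which bounds
   the weighted success probability and grows under one query by at most a
   factor 1 + 2 / (r 2^h). *)

(** * The family of graphs *)

Section SwitchGraph.
Variables I J : finType.

(** The boolean names one of two mirror copies; [inl i] is a row, [inr j] a column and [None] the
    end. The target will be the end of copy [true]. *)
Definition node := (bool * option (I + J))%type.

Definition out_nodes (X : I -> {set J}) (v : node) : seq node :=
  match v.2 with
  | Some (inl i) => [seq (v.1 (+) (j \in X i), Some (inr j)) | j <- enum J]
  | _ => [:: (v.1, None)]
  end.

Definition in_nodes (X : I -> {set J}) (v : node) : seq node :=
  match v.2 with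
  | Some (inl i) => [::]
  | Some (inr j) => [seq (v.1 (+) (j \in X i), Some (inl i)) | i <- enum I]
  | None => (v.1, None) :: [seq (v.1, Some (inr j)) | j <- enum J]
  end.

Lemma out_nodes_uniq X v : uniq (out_nodes X v).
Proof.
by case: v => s [[i|j]|] //; rewrite map_inj_uniq ?enum_uniq // => ? ? [].
Qed.

Lemma in_nodes_uniq X v : uniq (in_nodes X v).
Proof.
case: v => s [[i|j]|] //=; first by rewrite map_inj_uniq ?enum_uniq // => ? ? [].
rewrite map_inj_uniq ?enum_uniq ?andbT; last by move=> ? ? [].
by apply/mapP => -[].
Qed.

Lemma out_in_nodes X u v : (v \in out_nodes X u) = (u \in in_nodes X v).
Proof.
case: u v => s x [s' y]; rewrite /out_nodes /in_nodes /=.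
case: x => [[i|j]|]; case: y => [[i'|j']|];
  rewrite ?inE ?xpair_eqE ?andbF ?andbT ?orbF //=.
- by apply/negP => /mapP[].
- apply/mapP/mapP => [[j _ [-> ->]]|[i1 _ [-> ->]]].
  + by exists i; rewrite ?mem_enum // addbK.
  + by exists j'; rewrite ?mem_enum // addbK.
- by apply/idP/idP => /mapP[].
- by apply/esym/negP => /mapP[].
- apply/eqP/mapP => [->|[j1 _ [-> _]] //].
  by exists j; rewrite ?mem_enum.
- by apply/esym/negP => /mapP[].
- rewrite (eq_sym s'); case: (s == s') => //=.
  by apply/esym/negP => /mapP[].
Qed.

Definition lift_nodes (f : node -> seq node) (v : 'I_#|{: node}|) : seq 'I_#|{: node}| :=
  map enum_rank (f (enum_val v)).

Lemma lift_nodes_uniq f : (forall v, uniq (f v)) -> forall v, uniq (lift_nodes f v).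
Proof. by move=> Uf v; rewrite map_inj_uniq //; exact: enum_rank_inj. Qed.

Lemma lift_out_in X u v :
  (v \in lift_nodes (out_nodes X) u) = (u \in lift_nodes (in_nodes X) v).
Proof.
rewrite -{1}(enum_valK v) -{2}(enum_valK u) !mem_map; try exact: enum_rank_inj.
exact: out_in_nodes.
Qed.

Variable j0 : J.

Lemma lift_out_neq0 X v : lift_nodes (out_nodes X) v != [::].
Proof.
rewrite -size_eq0 size_map; case: (enum_val v) => s [[i|j]|] //.
by rewrite /out_nodes /= size_map -cardE -lt0n; apply/card_gt0P; exists j0.
Qed.

(* Rows point to columns, columns to ends, ends to themselves. The bit
   [j \in X i] tells whether the edges from the two copies of row [i] to the two
   copies of column [j] are parallel or crossed; degrees and positions in the
   adjacency lists do not depend on it, and one query reveals one bit. *)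
Definition switch_graph (X : I -> {set J}) : graph :=
  @Graph #|{: node}| (lift_nodes (out_nodes X)) (lift_nodes (in_nodes X))
    (@lift_nodes_uniq _ (out_nodes_uniq X)) (@lift_nodes_uniq _ (in_nodes_uniq X))
    (@lift_out_in X) (@lift_out_neq0 X).

Lemma card_node : #|{: node}| = (2 * (#|I| + #|J|).+1)%N.
Proof. by rewrite card_prod card_bool card_option card_sum. Qed.

Lemma nedges_switch X : nedges (switch_graph X) = (2 * (#|I| * #|J| + #|J| + 1))%N.
Proof.
rewrite /nedges /= (reindex enum_rank) /=; last by apply: onW_bij; exact: enum_rank_bij.
under eq_bigr do rewrite /lift_nodes size_map enum_rankK.
rewrite -(pair_bigA _ (fun s x => size (out_nodes X (s, x)))) big_bool /=.
have E s : (\sum_x size (out_nodes X (s, x)) = #|I| * #|J| + #|J| + 1)%N.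
  rewrite (bigD1 None) //= (reindex_omap Some id); last by case.
  rewrite (eq_bigl xpredT) => [|x]; last by rewrite eqxx.
  rewrite big_sumType /= addnC /out_nodes /=; congr (_ + _ + _)%N.
    by under eq_bigr do rewrite size_map -cardE; rewrite sum_nat_const.
  by rewrite sum1_card.
by rewrite !E mul2n addnn.
Qed.

Definition row_node (s : bool) (i : I) : 'I_#|{: node}| := enum_rank (s, Some (inl i)).
Definition col_node (s : bool) (j : J) : 'I_#|{: node}| := enum_rank (s, Some (inr j)).
Definition end_node (s : bool) : 'I_#|{: node}| := enum_rank (s, None).

(** The node type does not depend on [X], so one [cov] serves the whole family. Position [k] in the
    list of a row fixes the column; [X] decides only which of its copies is reached. *)
Lemma neighbour_out (cov : {set 'I_#|{: node}|}) (v : 'I_#|{: node}|) (k : nat)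
    (nb := fun X => @neighbour (switch_graph X) cov (lift_nodes (out_nodes X) v) k
            : answer * {set 'I_#|{: node}|}) :
  (exists r, forall X, nb X = r) \/ (exists i j r, forall X, nb X = r (j \in X i)).
Proof.
rewrite /nb /neighbour /lift_nodes /out_nodes.
case: (enum_val v) => s [[i|j]|] /=; try by left; eexists.
case E: (onth (enum J) k) => [j|]; last first.
  by left; exists (Illegal, cov) => X; rewrite 2!onth_map E.
right; exists i, j, (fun b => let w := col_node (s (+) b) j in (Node w, (w |: cov)%SET)) => X.
by rewrite 2!onth_map E.
Qed.

Lemma neighbour_in (cov : {set 'I_#|{: node}|}) (v : 'I_#|{: node}|) (k : nat)
    (nb := fun X => @neighbour (switch_graph X) cov (lift_nodes (in_nodes X) v) k
            : answer * {set 'I_#|{: node}|}) :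
  (exists r, forall X, nb X = r) \/ (exists i j r, forall X, nb X = r (j \in X i)).
Proof.
rewrite /nb /neighbour /lift_nodes /in_nodes.
case: (enum_val v) => s [[i|j]|] /=; try by left; eexists.
case E: (onth (enum I) k) => [i|]; last first.
  by left; exists (Illegal, cov) => X; rewrite 2!onth_map E.
right; exists i, j, (fun b => let w := row_node (s (+) b) i in (Node w, (w |: cov)%SET)) => X.
by rewrite 2!onth_map E.
Qed.

Lemma outcomes_switch (cov : {set 'I_#|{: node}|}) (a : query) :
  (exists r : seq (answer * {set 'I_#|{: node}|}),
    forall X, @outcomes (switch_graph X) cov a = r) \/
  (exists i j (r : bool -> seq (answer * {set 'I_#|{: node}|})),
    forall X, @outcomes (switch_graph X) cov a = r (j \in X i)).
Proof.
case: a => [|x|x|x k|x k] /=.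
- by left; eexists.
- left; rewrite /at_covered /=; case: pickP => [v _|_]; last by eexists.
  (* Degrees are the same for all [X], so the empty sets provide the answer. *)
  exists [:: (Degree (size (lift_nodes (in_nodes (fun=> finset.set0)) v)), cov)] => X.
  congr [:: (Degree _, _)]; rewrite /lift_nodes !size_map.
  by case: (enum_val v) => s [[i|j]|]; rewrite /in_nodes //= !size_map.
- left; rewrite /at_covered /=; case: pickP => [v _|_]; last by eexists.
  exists [:: (Degree (size (lift_nodes (out_nodes (fun=> finset.set0)) v)), cov)] => X.
  congr [:: (Degree _, _)]; rewrite /lift_nodes !size_map.
  by case: (enum_val v) => s [[i|j]|]; rewrite /out_nodes //= !size_map.
- rewrite /at_covered /=; case: pickP => [v _|_]; last by left; eexists.
  case: (neighbour_in cov v k) => [[r E]|[i [j [r E]]]].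
    by left; exists [:: r] => X; rewrite -(E X).
  by right; exists i, j, (fun b => [:: r b]) => X; rewrite -(E X).
- rewrite /at_covered /=; case: pickP => [v _|_]; last by left; eexists.
  case: (neighbour_out cov v k) => [[r E]|[i [j [r E]]]].
    by left; exists [:: r] => X; rewrite -(E X).
  by right; exists i, j, (fun b => [:: r b]) => X; rewrite -(E X).
Qed.

End SwitchGraph.

(** * PageRank of the rows *)

Section SwitchPageRank.
Variables (R : realType) (alpha : R) (I J : finType) (j0 : J) (X : I -> {set J}).
Hypothesis halpha : 0 < alpha < 1.

Local Notation G := (switch_graph j0 X).
Local Notation t := (end_node I J true : 'I_(nnodes G)).

Lemma stop_prob_end (s : bool) k :
  @stop_prob R alpha G t k (end_node I J s) = s%:R * alpha * (1 - alpha) ^+ k.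
Proof.
elim: k => [|k IH] /=.
  rewrite (inj_eq enum_rank_inj) xpair_eqE andbT expr0 mulr1 mulrC.
  by case: s.
rewrite {1 2}/lift_nodes enum_rankK /= big_seq1 /= -/(end_node I J s) IH divr1 exprS.
by rewrite mulrCA.
Qed.

Lemma stop_prob_column (s : bool) (j : J) k :
  @stop_prob R alpha G t k.+1 (col_node I s j) = s%:R * alpha * (1 - alpha) ^+ k.+1.
Proof.
rewrite /= {1 2}/lift_nodes enum_rankK /= big_seq1 /= -/(end_node I J s).
by rewrite stop_prob_end divr1 exprS mulrCA.
Qed.

(** The end is two moves away, hence [1 < k]. From copy [false] the walk changes to copy [true], and
    so reaches the target, exactly through the columns in [X i]; then it stays there until it
    stops. *)
Lemma stop_prob_row (i : I) k :
  @stop_prob R alpha G t k (row_node J false i) =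
  (#|X i|%:R / #|J|%:R * alpha * (1 - alpha) ^+ k) *+ (1 < k).
Proof.
case: k => [|k]; first by rewrite /= (inj_eq enum_rank_inj) xpair_eqE /= mulr0.
rewrite [LHS]/= {1 2}/lift_nodes enum_rankK /out_nodes /= 2!size_map -cardE 2!big_map big_enum /=.
case: k => [|k].
  rewrite big1 ?mul0r ?mulr0 // => j _ /=.
  by rewrite (inj_eq enum_rank_inj) xpair_eqE /= andbF mulr0.
under eq_bigr => j _ do rewrite -/(col_node I _ j) stop_prob_column.
rewrite -!mulr_suml -natr_sum -big_mkcond sum1_card mulr1n (exprS _ k.+1); ring.
Qed.

Lemma ppr_row (i : I) :
  @ppr R alpha G t (row_node J false i) = #|X i|%:R / #|J|%:R * (1 - alpha) ^+ 2.
Proof.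
(* Without its two zero terms the series is geometric of ratio [1 - alpha]. *)
rewrite /ppr; apply: cvg_lim => //; rewrite -(cvg_shiftn 2).
set r := #|X i|%:R / #|J|%:R.
have -> : (fun n => series ((@stop_prob R alpha G t)^~ (row_node J false i)) (n + 2)%N) =
    series (geometric (r * alpha * (1 - alpha) ^+ 2) (1 - alpha)).
  apply/funext; elim => [|n IH].
    by rewrite add0n 2!seriesSr !stop_prob_row !mulr0n !addr0 /series /= !big_geq.
  rewrite addSn !seriesSr IH stop_prob_row addn2 mulr1n /= -/r.
  by congr (_ + _); rewrite -addn2 exprD; ring.
have -> : r * (1 - alpha) ^+ 2 = r * alpha * (1 - alpha) ^+ 2 / (1 - (1 - alpha)).
  by case/andP: halpha => a0 _; field; lra.
by apply: cvg_geometric_series; case/andP: halpha => a0 a1; rewrite ger0_norm; lra.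
Qed.

End SwitchPageRank.

(** * The prior of a row *)

(** Compare the falling factorials factor by factor: [n - i <= 2 * (n - r - i)] for [i < h]. *)
Lemma bin_half (n r h : nat) : (2 * r + h <= n -> 'C(n, h) <= 2 ^ h * 'C(n - r, h))%N.
Proof.
move=> le_n; rewrite -(leq_pmul2r (fact_gt0 h)) bin_ffact -mulnA bin_ffact !ffact_prod.
have -> : (2 ^ h = \prod_(i < h) 2)%N by rewrite prod_nat_const card_ord.
by rewrite -big_split /= leq_prod // => i _; have := ltn_ord i; lia.
Qed.

Section RowPrior.
Variables (R : realFieldType) (J : finType) (B : {set J}) (h r : nat).

Definition heavy (A : {set J}) := (B \subset A) && (#|A :\: B| == h).

Definition draws : nat := 'C(#|~: B|, h).

(* Twice [draws] times the prior probability that the row hits exactly [A]. *)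
Definition weight (A : {set J}) : R := draws%:R * (A == B)%:R + (heavy A)%:R.

(** What is known about one row: [None] for a column not yet queried, [Some b] for a revealed
    bit. *)
Definition seen := {ffun J -> option bool}.

Definition consistent (s : seen) (A : {set J}) :=
  [forall j, (s j == None) || (s j == Some (j \in A))].

Definition queried (s : seen) : {set J} := [set j | s j != None]%SET.

Definition see (s : seen) (j : J) (b : bool) : seen :=
  [ffun j' => if j' == j then Some b else s j'].

Definition unseen : seen := [ffun=> None].

Definition mass (s : seen) : R := \sum_A weight A * (consistent s A)%:R.

(* At [d = 0] a lower bound on the number of heavy sets that survive [r]
   queries; the truncated subtraction makes it vanish from [d = r] on, and the
   linear decay is what bounds the growth per query. *)
Definition slack (d : nat) : R := draws%:R / 2 ^+ h * ((r - d)%:R / r%:R).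

(** Bounds the mass of the sets on which a single estimate can be right; the subtracted term is a
    loss forced by [B] and the heavy sets excluding each other. *)
Definition potential (s : seen) : R :=
  mass s - (consistent s B)%:R * slack #|queried s|.

Definition rate : R := 1 + 2 / (r%:R * 2 ^+ h).

Hypotheses (h_gt0 : (0 < h)%N) (r_gt0 : (0 < r)%N) (big_B : (2 * r + h <= #|~: B|)%N).

Lemma weight_ge0 A : 0 <= weight A.
Proof. by rewrite addr_ge0 ?mulr_ge0. Qed.

(** Adding [B] is a bijection from the [h]-subsets of the unqueried columns outside [B]: as [B] is
    consistent, every queried column outside [B] showed no hit. *)
Lemma card_heavy s : consistent s B ->
  #|[set A | heavy A & consistent s A]%SET| = 'C(#|~: B :\: queried s|, h).
Proof.
move=> /forallP sB; rewrite -cards_draws.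
have dj (H : {set J}) : H \subset ~: B :\: queried s -> (B :|: H) :\: B = H.
  move=> /fintype.subsetP sH; apply/finset.setP => x; rewrite !inE; case xB: (x \in B) => //=.
  by apply/esym/negP => /sH; rewrite !inE xB andbF.
rewrite -[RHS](card_in_imset (f := fun H : {set J} => B :|: H)); last first.
  move=> H H'; rewrite !inE => /andP[sH _] /andP[sH' _] /(congr1 (fun A => A :\: B)).
  by rewrite !dj.
apply: eq_card => A; rewrite inE; apply/andP/imsetP => [[]|[H]].
  move=> /andP[sBA cA] /forallP sA; exists (A :\: B); last first.
    rewrite finset.setDE finset.setUIr finset.setUCr finset.setIT.
    exact/esym/finset.setUidPr.
  rewrite inE cA andbT; apply/fintype.subsetP => x; rewrite !inE => /andP[xB xA].
  rewrite xB andbT; have := sA x; have := sB x; rewrite xA (negbTE xB).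
  by case: (s x) => // -[].
rewrite inE => /andP[sH cH ->]; rewrite /heavy finset.subsetUl dj // cH; split => //.
apply/forallP => x; have := sB x; case: eqP => //= sx /eqP ->; rewrite !inE.
case xB: (x \in B) => //=; case xH: (x \in H) => //.
by have := fintype.subsetP sH _ xH; rewrite !inE; case: eqP sx.
Qed.

Lemma massE s :
  mass s = draws%:R * (consistent s B)%:R + #|[set A | heavy A & consistent s A]%SET|%:R.
Proof.
rewrite /mass; under eq_bigr do rewrite mulrDl.
rewrite big_split /=; congr (_ + _).
  rewrite (bigD1 B) //= eqxx mulr1 big1 ?addr0 // => A /negbTE ->.
  by rewrite mulr0 mul0r.
rewrite -sum1_card natr_sum [RHS]big_mkcond /=; apply: eq_bigr => A _.
by rewrite inE; case: heavy; case: consistent; rewrite ?mulr0 ?mul0r ?mulr1.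
Qed.

Lemma mass_unseen : mass unseen = 2 * draws%:R.
Proof.
have c A : consistent unseen A by apply/forallP => j; rewrite ffunE eqxx.
rewrite massE card_heavy // c mulr1.
have -> : queried unseen = finset.set0 by apply/finset.setP => j; rewrite !inE ffunE.
by rewrite finset.setD0 -/draws; ring.
Qed.

Lemma slack_ge0 d : 0 <= slack d.
Proof. by rewrite /slack !mulr_ge0 ?invr_ge0 ?exprn_ge0. Qed.

Lemma slack0 : slack 0 = draws%:R / 2 ^+ h.
Proof. by rewrite /slack subn0 divff ?mulr1 // pnatr_eq0 -lt0n. Qed.

Lemma slack_le d : slack d <= slack 0.
Proof.
rewrite /slack ler_wpM2l ?mulr_ge0 ?invr_ge0 ?exprn_ge0 //.
by rewrite ler_wpM2r ?invr_ge0 // ler_nat leq_sub2l.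
Qed.

(** With fewer than [r] columns queried, at least a fraction [2^-h] of the heavy sets survives by
    [bin_half]; from [r] on the slack is 0. *)
Lemma slack_survive s : consistent s B ->
  slack #|queried s| <= #|[set A | heavy A & consistent s A]%SET|%:R.
Proof.
move=> cB; rewrite card_heavy //; have [r_le|lt_r] := leqP r #|queried s|.
  by rewrite /slack (eqP r_le) mul0r mulr0.
apply: le_trans (slack_le _) _; rewrite slack0 ler_pdivrMr ?exprn_gt0 //.
rewrite -natrX -natrM ler_nat mulnC.
apply: leq_trans (bin_half big_B) _; rewrite leq_mul2l leq_bin2l ?orbT //.
by rewrite cardsD leq_sub2l //;
  apply: leq_trans (subset_leq_card (finset.subsetIr _ _)) (ltnW lt_r).
Qed.

(** If [ok] accepts [B], every surviving heavy set is lost; otherwise [B] is lost, with weight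
    [draws]. Either loss is at least the slack. *)
Lemma potential_ok (ok : pred {set J}) (s : seen) :
  (forall A, heavy A -> ~~ (ok B && ok A)) ->
  \sum_A weight A * (consistent s A)%:R * (ok A)%:R <= potential s.
Proof.
move=> okB; rewrite /potential; case: (boolP (consistent s B)) => cB; last first.
  rewrite mul0r subr0 ler_sum // => A _.
  by rewrite ler_piMr ?mulr_ge0 ?weight_ge0 // lern1 leq_b1.
rewrite mul1r massE cB mulr1 [leLHS](_ : _ = draws%:R * (ok B)%:R +
    \sum_(A | heavy A && consistent s A) (ok A)%:R); last first.
  under eq_bigr do rewrite !mulrDl.
  rewrite big_split /=; congr (_ + _).
    rewrite (bigD1 B) //= eqxx cB !mulr1 big1 ?addr0 // => A /negbTE ->.
    by rewrite mulr0 !mul0r.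
  rewrite [RHS]big_mkcond /=; apply: eq_bigr => A _.
  by case: heavy; case: consistent; rewrite ?mulr0 ?mul0r ?mul1r.
have [okb|nokB] := boolP (ok B).
  rewrite big1 ?addr0 => [|A /andP[hA _]]; last first.
    by have := okB _ hA; rewrite okb; case: (ok A).
  by rewrite mulr1 -addrA lerDl subr_ge0 slack_survive.
rewrite mulr0 add0r addrAC.
apply: le_trans (_ : #|[set A | heavy A & consistent s A]%SET|%:R <= _); last first.
  rewrite lerDr subr_ge0; apply: le_trans (slack_le _) _.
  by rewrite slack0 ler_pdivrMr ?exprn_gt0 // ler_peMr // exprn_ege1 // ler1n.
rewrite -sum1_card natr_sum [leRHS](eq_bigl (fun A => heavy A && consistent s A)); last first.
  by move=> A; rewrite inE.
by apply: ler_sum => A _; rewrite ler_nat leq_b1.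
Qed.

Lemma potential_ge0 s : 0 <= potential s.
Proof.
apply: le_trans (potential_ok s (ok := xpred0) _) => //.
by rewrite big1 // => A _; rewrite mulr0.
Qed.

Lemma consistent_see (s : seen) j b A : s j = None ->
  consistent (see s j b) A = consistent s A && ((j \in A) == b).
Proof.
move=> sj; apply/forallP/andP => [sA|[/forallP sA /eqP <-] x].
  split; last by have := sA j; rewrite ffunE eqxx /= => /eqP[->].
  apply/forallP => x; have := sA x; rewrite ffunE.
  by case: (x =P j) => // ->; rewrite sj.
by rewrite ffunE; case: (x =P j) => [->|_]; [rewrite eqxx orbT|apply: sA].
Qed.

Lemma queried_see (s : seen) j b : s j = None -> #|queried (see s j b)| = #|queried s|.+1.
Proof.
move=> sj; have -> : queried (see s j b) = j |: queried s.
  by apply/finset.setP => x; rewrite !inE ffunE; case: (x == j).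
by rewrite cardsU1 inE sj.
Qed.

Lemma mass_see (s : seen) j : s j = None -> mass (see s j true) + mass (see s j false) = mass s.
Proof.
move=> sj; rewrite /mass -big_split /=; apply: eq_bigr => A _.
rewrite !consistent_see // -mulrDr; congr (_ * _).
by case: consistent => //=; case: (j \in A); rewrite ?addr0 ?add0r.
Qed.

(** The bit splits the mass exactly, and only the answer agreeing with [B] keeps a slack term. So
    the sum grows by at most the drop of the slack, [draws / (r * 2^h)], while the potential is at
    least [draws / 2] if [B] is consistent. *)
Lemma potential_see (s : seen) j : s j = None ->
  potential (see s j true) + potential (see s j false) <= rate * potential s.
Proof.
move=> sj; have hr : 0 < (r%:R : R) by rewrite ltr0n.
have h2 : 2 <= (2 : R) ^+ h.
  by rewrite -[leLHS]expr1 ler_weXn2l // ler1n.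
have rate1 : 0 <= 2 / (r%:R * 2 ^+ h) :> R by rewrite divr_ge0 ?mulr_ge0 ?exprn_ge0.
rewrite {1 2}/potential addrACA mass_see // !consistent_see // !queried_see //.
have [cB|ncB] := boolP (consistent s B); last first.
  have -> : potential s = mass s by rewrite /potential (negbTE ncB) mul0r subr0.
  rewrite !mul0r !subr0 /rate mulrDl mul1r lerDl mulr_ge0 //.
  by rewrite sumr_ge0 // => A _; rewrite mulr_ge0 ?weight_ge0.
set d := #|_|.
have -> : forall x : R, - ((true && ((j \in B) == true))%:R * x) -
    (true && ((j \in B) == false))%:R * x = - x.
  by move=> x; case: (j \in B); rewrite ?mul1r ?mul0r ?subr0 ?sub0r ?oppr0 ?add0r.
have pge : draws%:R / 2 <= potential s.
  rewrite /potential cB mul1r massE cB mulr1.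
  have := slack_le d; rewrite slack0 -/d => sl.
  have : draws%:R / 2 ^+ h <= draws%:R / 2 :> R.
    by rewrite ler_wpM2l // lef_pV2 ?posrE // exprn_gt0.
  have : 0 <= #|[set A | heavy A & consistent s A]%SET|%:R :> R by [].
  lra.
have sd : slack d <= slack d.+1 + draws%:R / (r%:R * 2 ^+ h).
  rewrite /slack invfM (mulrC r%:R^-1) [X in _ + X]mulrA -mulrDr ler_wpM2l ?divr_ge0 ?exprn_ge0 //.
  rewrite ler_pdivrMr // mulrDl divfK ?mulVf ?gt_eqF // natr1 ler_nat; lia.
rewrite /rate mulrDl mul1r {1}/potential cB mul1r -/d.
have : 2 / (r%:R * 2 ^+ h) * (draws%:R / 2) <= 2 / (r%:R * 2 ^+ h) * potential s :> R.
  by rewrite ler_wpM2l.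
have -> : 2 / (r%:R * 2 ^+ h) * (draws%:R / 2) = draws%:R / (r%:R * 2 ^+ h) :> R.
  by rewrite mulrC -mulrA mulKf.
lra.
Qed.

End RowPrior.

(** * The potential of a state *)

Section Game.
Variables (R : realType) (I J : finType) (j0 : J) (B : {set J}) (h r : nat).
Hypotheses (h_gt0 : (0 < h)%N) (r_gt0 : (0 < r)%N) (big_B : (2 * r + h <= #|~: B|)%N).
Variables (strategy : seq answer -> action R).
Variables (ok : (I -> {set J}) -> (nat -> R) -> bool).
Variables (good : I -> {set J} -> (nat -> R) -> bool).
Hypothesis ok_good : forall X est i, ok X est -> good i (X i) est.
Hypothesis good_sep : forall i A est, heavy B h A -> ~~ (good i B est && good i A est).

Local Notation cover := {set 'I_#|{: node I J}|}.

(** Rows are independent: up to a constant factor, this is the probability that the hidden sets are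
    [X] and agree with all that was seen. *)
Definition joint (s : I -> seen J) (X : {ffun I -> {set J}}) : R :=
  \prod_i (weight R B h (X i) * (consistent (s i) (X i))%:R).

Definition success (q : nat) (cov : cover) (hist : seq answer) (X : I -> {set J}) : R :=
  @success_from (switch_graph j0 X) R strategy (ok X) q cov hist.

Definition see_at (s : I -> seen J) (i : I) (j : J) (b : bool) : I -> seen J :=
  fun i' => if i' == i then see (s i) j b else s i'.

Local Notation pot s := (\prod_i potential R B h r (s i)).

Lemma joint_ge0 s X : 0 <= joint s X.
Proof. by apply: prodr_ge0 => i _; rewrite mulr_ge0 ?weight_ge0. Qed.

Lemma joint_see (s : I -> seen J) i j b X : s i j = None ->
  joint (see_at s i j b) X = joint s X * ((j \in X i) == b)%:R.
Proof.
move=> sij; rewrite /joint (bigD1 i) //= [in RHS](bigD1 i) //= /see_at eqxx.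
rewrite consistent_see // [RHS]mulrAC; congr (_ * _).
  by rewrite -mulrA -natrM mulnb.
by apply: eq_bigr => i' /negbTE ->.
Qed.

Lemma pot_ge0 (s : I -> seen J) : 0 <= pot s.
Proof. by apply: prodr_ge0 => i _; exact: potential_ge0. Qed.

Lemma pot_see (s : I -> seen J) i j : s i j = None ->
  pot (see_at s i j true) + pot (see_at s i j false) <= rate R h r * pot s.
Proof.
move=> sij; have E b : pot (see_at s i j b) =
    potential R B h r (see (s i) j b) * \prod_(i' | i' != i) potential R B h r (s i').
  rewrite (bigD1 i) //= /see_at eqxx; congr (_ * _).
  by apply: eq_bigr => i' /negbTE ->.
rewrite !E -mulrDl [in leRHS](bigD1 i) //= mulrA ler_wpM2r ?potential_see //.
by apply: prodr_ge0 => i' _; exact: potential_ge0.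
Qed.

Lemma rate_ge1 : 1 <= rate R h r.
Proof. by rewrite /rate lerDl divr_ge0 ?mulr_ge0 ?exprn_ge0. Qed.

(** Since [ok] implies [good] in every row, the sum is at most a sum of products over the rows. This
    factors into a product of sums, each bounded by [potential_ok]. *)
Lemma joint_return (s : I -> seen J) est : \sum_X joint s X * (ok X est)%:R <= pot s.
Proof.
apply: le_trans (_ : \sum_(X : {ffun I -> {set J}}) \prod_i
   (weight R B h (X i) * (consistent (s i) (X i))%:R * (good i (X i) est)%:R) <= _).
  apply: ler_sum => X _; rewrite big_split ler_wpM2l ?joint_ge0 //=.
  case: (boolP (ok X est)) => [okX|_]; last by apply: prodr_ge0 => i _.
  by rewrite big1 // => i _; rewrite ok_good.
rewrite -(bigA_distr_bigA (fun i A =>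
  weight R B h A * (consistent (s i) A)%:R * (good i A est)%:R)).
apply: ler_prod => i _; rewrite sumr_ge0 => [|A _]; last by rewrite !mulr_ge0 ?weight_ge0.
apply: (@potential_ok _ _ _ _ _ r_gt0 big_B (fun A => good i A est)) => A; exact: good_sep.
Qed.

Lemma joint_average q hist s (o : seq (answer * cover)) (F : R) : 0 <= F ->
  (forall x, \sum_X joint s X * success q x.2 (rcons hist x.1) X <= F) ->
  \sum_X joint s X * ((\sum_(x <- o) success q x.2 (rcons hist x.1) X) / (size o)%:R) <= F.
Proof.
move=> F0 le_F; under eq_bigr do rewrite mulrA mulr_sumr.
rewrite -mulr_suml exchange_big /=.
(* With no outcomes the quotient is 0, as division by 0 gives 0. *)
have [->|o0] := eqVneq (size o) 0%N; first by rewrite invr0 mulr0.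
rewrite ler_pdivrMr ?ltr0n ?lt0n // mulr_natr.
apply: le_trans (ler_sum _ (fun x _ => le_F x)) _.
by rewrite big_const_seq count_predT iter_addr_0.
Qed.

(** Induction on [q]: a query whose outcome is independent of [X] or repeats a known bit leaves the
    potential unchanged; a new bit costs one factor [rate] by [pot_see]. *)
Lemma success_potential q cov hist s :
  \sum_X joint s X * success q cov hist X <= rate R h r ^+ q * pot s.
Proof.
elim: q cov hist s => [|q IH] cov hist s; rewrite /success /=; case E: (strategy hist) => [a|est].
- by rewrite big1 ?expr0 ?mul1r ?pot_ge0 // => X _; rewrite mulr0.
- by rewrite expr0 mul1r; exact: joint_return.
- have IH' s' res : \sum_X joint s' X *
      ((\sum_(x <- res) success q x.2 (rcons hist x.1) X) / (size res)%:R)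
        <= rate R h r ^+ q * pot s'.
    apply: joint_average => [|x]; last exact: IH.
    by rewrite mulr_ge0 ?exprn_ge0 ?pot_ge0 // (le_trans ler01) ?rate_ge1.
  have leS : rate R h r ^+ q * pot s <= rate R h r ^+ q.+1 * pot s.
    by rewrite ler_wpM2r ?pot_ge0 // ler_weXn2l ?rate_ge1.
  case: (outcomes_switch j0 cov a) => [[res out]|[i [j [res out]]]].
    apply: le_trans leS; apply: le_trans (IH' s res).
    by apply: ler_sum => X _; rewrite out.
  case sij: (s i j) => [b|].
    apply: le_trans leS; apply: le_trans (IH' s (res b)).
    apply: ler_sum => X _; rewrite out.
    (* A known bit is the same in every [X] of nonzero weight. *)
    case: (eqVneq (joint s X) 0) => [->|]; first by rewrite !mul0r.
    rewrite prodf_seq_neq0 => /allP/(_ i (mem_index_enum _)).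
    rewrite mulf_eq0 negb_or => /andP[_]; rewrite pnatr_eq0 eqb0 negbK => /forallP/(_ j).
    by rewrite sij /= => /eqP[->].
  apply: le_trans (_ : rate R h r ^+ q *
      (pot (see_at s i j true) + pot (see_at s i j false)) <= _); last first.
    by rewrite exprSr -mulrA ler_wpM2l ?pot_see // exprn_ge0 // (le_trans ler01) ?rate_ge1.
  rewrite mulrDr.
  apply: le_trans (lerD (IH' (see_at s i j true) (res true))
    (IH' (see_at s i j false) (res false))).
  (* Each [X] keeps its weight in the state recording its own bit and has weight 0 in the other. *)
  rewrite -big_split /=; apply: ler_sum => X _; rewrite out !joint_see //.
  by case: (j \in X i); rewrite !(mulr1, mulr0, mul0r, addr0, add0r).
- apply: le_trans (joint_return s est) _.
  by rewrite ler_peMl ?pot_ge0 // exprn_ege1 ?rate_ge1.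
Qed.

End Game.

(** * Integrals over the coins *)

Section SuccessFrom.
Variables (R : realType) (G : graph) (strategy : seq answer -> action R).
Variable ok : (nat -> R) -> bool.

Lemma success_from_ge0 q (cov : {set 'I_(nnodes G)}) hist :
  0 <= success_from strategy ok q cov hist.
Proof.
elim: q cov hist => [|q IH] cov hist /=; case: (strategy hist) => [a|est] //.
by rewrite divr_ge0 // sumr_ge0.
Qed.

Lemma success_from_mono q q' (cov : {set 'I_(nnodes G)}) hist : (q <= q')%N ->
  success_from strategy ok q cov hist <= success_from strategy ok q' cov hist.
Proof.
elim: q q' cov hist => [|q IH] [|q'] cov hist //=; case: (strategy hist) => [a|est] // lq.
  by rewrite divr_ge0 // sumr_ge0 // => x _; exact: success_from_ge0.
by rewrite ler_wpM2r ?invr_ge0 // ler_sum // => x _; exact: IH.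
Qed.

End SuccessFrom.

(** The integral of a nonnegative function is the supremum over the simple functions below it,
    whether or not it is measurable. *)
Lemma simple_below d (T : measurableType d) (R : realType)
    (mu : {measure set T -> \bar R}) (f : T -> \bar R) (a : R) :
  (forall x, 0 <= f x)%E -> (a%:E < \int[mu]_x f x)%E ->
  exists2 g : {nnsfun T >-> R}, (forall x, (g x)%:E <= f x)%E & (a%:E <= \int[mu]_x (g x)%:E)%E.
Proof.
move=> f0; rewrite ge0_integralTE // => /ereal_sup_gt[_ [g gf <-] ag].
by exists g => //; rewrite integralT_nnsfun ltW.
Qed.

(* The functions [f k] need not be measurable, since the lower integral is
   superadditive. *)
Lemma exists_small_integral d (T : measurableType d) (R : realType) (P : probability T R)
    (K : finType) (w : K -> R) (f : K -> T -> R) (a b : R) :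
  (forall k, 0 <= w k) -> 0 < \sum_k w k -> a < b ->
  (forall k x, 0 <= f k x) -> (forall x, \sum_k w k * f k x <= a * \sum_k w k) ->
  exists k, forall g : T -> R, (forall x, 0 <= g x <= f k x) -> (\int[P]_x (g x)%:E < b%:E)%E.
Proof.
move=> w0 W0 ab f0 wf; apply: contrapT => /forallNP nk.
(* The midpoint leaves room for the loss in passing to simple functions. *)
pose c := (a + b) / 2; have [ac cb] : a < c /\ c < b by rewrite /c; lra.
have /choice[phi phiP] : forall k, exists phi : {nnsfun T >-> R},
    (forall x, phi x <= f k x) /\ (c%:E <= \int[P]_x (phi x)%:E)%E.
  move=> k; have /existsNP[g /not_implyP[g0 /negP]] := nk k.
  rewrite -leNgt => bg; have cg : (c%:E < \int[P]_x (g x)%:E)%E.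
    by rewrite (lt_le_trans _ bg) ?lte_fin.
  case: (simple_below _ cg) => [x|phi phig cphi]; first by case/andP: (g0 x).
  exists phi; split=> // x; case/andP: (g0 x) => _; apply: le_trans.
  by rewrite -lee_fin.
have : (\int[P]_x (\sum_k (w k)%:E * (phi k x)%:E) <= (a * \sum_k w k)%:E)%E.
  rewrite -[leRHS]mule1 -(@probability_setT _ _ _ P) -integral_cst //.
  apply: ge0_le_integral => //.
  - by move=> x _; rewrite sume_ge0 // => k _; rewrite mule_ge0 ?lee_fin.
  - apply: emeasurable_sum => k; apply: measurable_funeM.
    exact/measurable_realfun.measurable_EFinP.
  - move=> x _; under eq_bigr do rewrite -EFinM; rewrite sumEFin lee_fin.
    apply: le_trans (wf x); apply: ler_sum => k _.
    by rewrite ler_wpM2l //; case: (phiP k).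
apply/negP; rewrite -ltNge ge0_integral_sum //=; last 2 first.
- by move=> k; apply: measurable_funeM; exact/measurable_realfun.measurable_EFinP.
- by move=> k x _; rewrite mule_ge0 ?lee_fin.
apply: lt_le_trans (_ : (c * \sum_k w k)%:E <= _)%E; first by rewrite lte_fin ltr_pM2r.
rewrite mulrC mulr_suml -sumEFin; apply: lee_sum => k _.
rewrite ge0_integralZl_EFin //; last 2 first.
- by move=> x _; rewrite lee_fin.
- exact/measurable_realfun.measurable_EFinP.
by rewrite EFinM lee_wpmul2l ?lee_fin //; case: (phiP k).
Qed.

(** * Hard instances *)

Lemma sum_joint (R : realType) (I J : finType) (B : {set J}) (h r : nat) :
  (0 < h)%N -> (2 * r + h <= #|~: B|)%N ->
  \sum_X joint R B h (fun _ : I => unseen J) X = (2 * (draws B h)%:R) ^+ #|I|.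
Proof.
move=> h_gt0 big_B; rewrite /joint -(bigA_distr_bigA (fun _ A =>
  weight R B h A * (consistent (unseen J) A)%:R)) /=.
by rewrite prodr_const -/(mass R B h (unseen J)) mass_unseen.
Qed.

(** With [x = 2^-h], each row starts at a fraction [1 - x / 2] of its mass, and [q] queries
    contribute a factor of at most [expR (x * #|I| / 4)]. Together this is at most
    [expR (- (x * #|I| / 4))], and [1 + y <= expR y] gives the inverse. *)
Lemma average_success (R : realType) (I J : finType) (j0 : J) (B : {set J}) (h r q : nat)
    (strategy : seq answer -> action R) (ok : (I -> {set J}) -> (nat -> R) -> bool)
    (good : I -> {set J} -> (nat -> R) -> bool) cov :
  (0 < h)%N -> (0 < r)%N -> (2 * r + h <= #|~: B|)%N ->
  (forall X est i, ok X est -> good i (X i) est) ->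
  (forall i A est, heavy B h A -> ~~ (good i B est && good i A est)) ->
  (8 * q <= #|I| * r)%N ->
  \sum_X joint R B h (fun=> unseen J) X * success j0 strategy ok q cov [::] X
    <= (1 + #|I|%:R / (4 * 2 ^+ h))^-1 * \sum_X joint R B h (fun _ : I => unseen J) X.
Proof.
move=> h_gt0 r_gt0 big_B ok_good good_sep le_q.
apply: le_trans (success_potential _ h_gt0 r_gt0 big_B _ ok_good good_sep _ _ _ _) _.
rewrite (sum_joint R I h_gt0 big_B) prodr_const.
have hr : 0 < (r%:R : R) by rewrite ltr0n.
have th : 0 < (2 ^+ h : R)^-1 by rewrite invr_gt0 exprn_gt0.
have th1 : (2 ^+ h : R)^-1 <= 1 by rewrite invf_le1 ?exprn_gt0 // exprn_ege1 // ler1n.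
have -> : potential R B h r (unseen J) = (1 - (2 ^+ h)^-1 / 2) * (2 * (draws B h)%:R).
  rewrite /potential (_ : consistent _ _); last by apply/forallP => j; rewrite ffunE eqxx.
  rewrite (_ : queried _ = finset.set0); last by apply/finset.setP => j; rewrite !inE ffunE.
  by rewrite cards0 slack0 // mass_unseen // mul1r; set x := (2 ^+ h)^-1; field.
rewrite exprMn mulrA ler_wpM2r ?exprn_ge0 ?mulr_ge0 //.
set x := (2 ^+ h)^-1 : R in th th1 *.
have rateE : rate R h r <= expR (2 * x / r%:R).
  by rewrite /rate invfM -/x (mulrC _ x) mulrA expR_ge1Dx.
apply: le_trans (_ : expR (2 * x / r%:R) ^+ q * expR (- (x / 2)) ^+ #|I| <= _).
  apply: ler_pM.
  - by rewrite exprn_ge0 // (le_trans ler01) ?rate_ge1.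
  - by rewrite exprn_ge0 //; lra.
  - by rewrite lerXn2r ?nnegrE ?expR_ge0 // (le_trans ler01) ?rate_ge1.
  - by rewrite lerXn2r ?nnegrE ?expR_ge0 ?expR_ge1Dx //; lra.
rewrite -!expRM_natl -expRD.
apply: le_trans (_ : expR (- (x * #|I|%:R / 4)) <= _).
  rewrite ler_expR.
  have : x * (8 * q%:R / r%:R) <= x * #|I|%:R.
    by rewrite ler_wpM2l ?(ltW th) // ler_pdivrMr // -!natrM ler_nat.
  have -> : q%:R * (2 * x / r%:R) = x * (8 * q%:R / r%:R) / 4 by field; rewrite gt_eqF.
  lra.
have pos : 0 < 1 + #|I|%:R / (4 * 2 ^+ h) :> R.
  by rewrite ltr_pwDl // divr_ge0 ?mulr_ge0 ?exprn_ge0.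
rewrite expRN lef_pV2 ?posrE ?expR_gt0 //.
rewrite (_ : #|I|%:R / (4 * 2 ^+ h) = x * #|I|%:R / 4) ?expR_ge1Dx //.
by rewrite invfM -/x; field.
Qed.

Lemma row_accurate (R : realType) (alpha c delta : R) (I J : finType) (j0 : J)
    (X : I -> {set J}) (est : nat -> R) (i : I) (v := #|X i|%:R / #|J|%:R * (1 - alpha) ^+ 2) :
  0 < alpha < 1 -> delta <= v ->
  @accurate R alpha (switch_graph j0 X) (end_node I J true) c delta est ->
  `|est (val (row_node J false i)) - v| <= c * v.
Proof.
move=> halpha dv /forallP/(_ (row_node J false i)); rewrite ppr_row // -/v dv.
by [].
Qed.

(** [exists_small_integral] turns a bound on average over [X], valid for any fixed coins, into one
    [X] that is hard on average over the coins. *)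
Lemma hard_instance (R : realType) (alpha p c delta : R) (A : algorithm R) (n k r : nat) :
  0 < alpha < 1 -> 0 <= c <= 1 / 2 -> (0 < k)%N -> (0 < r)%N -> (k < r)%N ->
  delta <= k%:R / (k + 4 * r)%:R * (1 - alpha) ^+ 2 ->
  (1 + n%:R / (4 * 2 ^+ (2 * k).+1))^-1 < 1 - p ->
  exists (U : graph) (t : 'I_(nnodes U)),
    [/\ nnodes U = (2 * (n + (k + 4 * r)).+1)%N,
        nedges U = (2 * (n * (k + 4 * r) + (k + 4 * r) + 1))%N
      & forall q, ((1 - p)%:E <= success_within alpha c delta A t q)%E -> (n * r < 8 * q)%N].
Proof.
move=> halpha hc k0 r0 kr hdelta hp.
pose J := ('I_k + 'I_(4 * r))%type; pose I := 'I_n.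
pose j0 : J := inl (Ordinal k0).
pose B : {set J} := [set inl i | i : 'I_k]%SET.
have cJ : #|{: J}| = (k + 4 * r)%N by rewrite card_sum !card_ord.
have cB : #|B| = k by rewrite card_imset ?card_ord // => ? ? [].
have cBC : #|~: B| = (4 * r)%N by rewrite cardsCs finset.setCK cB cJ addKn.
pose h := (2 * k).+1; have h0 : (0 < h)%N by [].
have big_B : (2 * r + h <= #|~: B|)%N by rewrite cBC /h; lia.
pose value (D : {set J}) : R := #|D|%:R / #|{: J}|%:R * (1 - alpha) ^+ 2.
pose good (i : I) (D : {set J}) (est : nat -> R) :=
  (delta <= value D) ==> (`|est (val (row_node J false i)) - value D| <= c * value D).
pose ok (X : I -> {set J}) (est : nat -> R) :=
  @accurate R alpha (switch_graph j0 X) (end_node I J true) c delta est.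
have ok_good X est i : ok X est -> good i (X i) est.
  by move=> okX; apply/implyP => dv; apply: row_accurate okX.
(* (1 - c) (3 k + 1) > (1 + c) k because c <= 1 / 2 *)
have good_sep i D est : heavy B h D -> ~~ (good i B est && good i D est).
  move=> /andP[BD /eqP cD].
  have cDk : #|D| = (3 * k + 1)%N.
    by rewrite -(cardsID B D) cD (finset.setIidPr BD) cB /h; lia.
  have dB : delta <= value B by rewrite /value cB cJ.
  pose u : R := (1 - alpha) ^+ 2 / #|{: J}|%:R.
  have u0 : 0 < u.
    by case/andP: halpha => _ a1; rewrite divr_gt0 ?exprn_gt0 ?subr_gt0 // ltr0n cJ; lia.
  have vB : value B = k%:R * u by rewrite /value cB mulrAC -mulrA.
  have vD : value D = (3 * k%:R + 1) * u.
    by rewrite /value cDk natrD natrM mulrAC -mulrA.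
  clearbody u; have kR : 0 < k%:R :> R by rewrite ltr0n.
  have dD : delta <= value D by rewrite (le_trans dB) // vB vD ler_pM2r //; lra.
  apply/negP; rewrite /good dB dD /= !ler_norml => /andP[/andP[_ e1] /andP[e2 _]].
  have : (1 - c) * value D <= (1 + c) * value B by lra.
  rewrite vB vD !mulrA ler_pM2r // => H.
  have : c * k%:R <= 1 / 2 * k%:R by rewrite ler_wpM2r //; lra.
  lra.
(* The label of the target is the same for all [X], so one strategy faces the whole family. *)
pose play w := @step R A (val (end_node I J true)) w.
have avg q cov w := @average_success R I J j0 B h r q (play w) ok good cov
  h0 r0 big_B ok_good good_sep.
(* The largest number of queries covered by [average_success]; smaller numbers follow by
   monotonicity. *)
pose q0 := ((n * r) %/ 8)%N.
have [] := @exists_small_integral _ _ R (coin_law A) {ffun I -> {set J}}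
  (joint R B h (fun=> unseen J))
  (fun X w => success j0 (play w) ok q0 [set end_node I J true]%SET [::] X)
  _ (1 - p) _ _ hp.
- by move=> X; exact: joint_ge0.
- rewrite (sum_joint R I h0 big_B) exprn_gt0 // mulr_gt0 // ltr0n bin_gt0; lia.
- by move=> X w; exact: success_from_ge0.
- move=> x; have := avg q0 [set end_node I J true]%SET x; rewrite card_ord.
  by apply; rewrite mulnC leq_divM.
move=> X HX; exists (switch_graph j0 X), (end_node I J true); split.
- by rewrite /= card_node card_ord cJ.
- by rewrite nedges_switch card_ord cJ.
move=> q; apply: contraTT; rewrite -leqNgt -ltNge => le_q.
apply: HX => w; rewrite success_from_ge0 /=; apply: success_from_mono.
by rewrite leq_divRL // mulnC.
Qed.

(** * Choice of the parameters *)

Lemma exp2_le_expR (R : realType) (h : nat) : 2 ^+ h <= expR h%:R :> R.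
Proof.
by rewrite -[h%:R]mulr1 expRM_natl lerXn2r ?nnegrE ?expR_ge0 // (le_trans _ (expR_ge1Dx _)).
Qed.

Lemma choose_parameters (R : realType) (beta delta p : R) (n : nat) (x : R) :
  0 < beta -> 0 < delta <= beta / 20 -> p < 1 -> 0 <= x ->
  delta * x <= beta / 20 * ln n%:R ->
  (0 < n)%N -> (4 * expR 5 / (1 - p)) ^+ 2 <= n%:R ->
  exists k r : nat, [/\ (0 < k)%N, (k < r)%N, x <= r%:R <= x + 3,
    delta <= k%:R / (k + 4 * r)%:R * beta
  & (1 + n%:R / (4 * 2 ^+ (2 * k).+1))^-1 < 1 - p].
Proof.
move=> b0 /andP[d0 db] p1 x0 dx n0 hn.
(* The 5 comes from [k + 4 * r <= 5 * r]; then [y <= r / 4] and [3 <= r] give [k < r]. *)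
pose r := (Num.trunc x + 3)%N; pose y := 5 * delta * r%:R / beta; pose k := (Num.trunc y).+1.
have /andP[rx xr] : x <= r%:R <= x + 3.
  have /andP[t1 t2] := truncn_itv x0.
  by rewrite natrD lerD2r t1 andbT; move: t2; rewrite -natr1; lra.
have y0 : 0 <= y by rewrite !mulr_ge0 ?invr_ge0 // ltW.
have /andP[ky yk] : y <= k%:R <= y + 1.
  have /andP[t1 t2] := truncn_itv y0.
  by rewrite (ltW t2) /= -natr1 lerD2r.
have r3 : 3 <= r%:R :> R by rewrite ler_nat leq_addl.
have yE : y * beta = 5 * delta * r%:R by rewrite /y divfK // gt_eqF.
have y4 : y <= r%:R / 4.
  rewrite -(ler_pM2r b0) yE.
  have : delta * r%:R <= beta / 20 * r%:R by rewrite ler_wpM2r.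
  lra.
have kr : (k < r)%N by rewrite -(ltr_nat R); lra.
have krR : k%:R <= r%:R :> R by rewrite ler_nat ltnW.
exists k, r; split => //; first by rewrite rx.
  rewrite mulrAC ler_pdivlMr; last by rewrite ltr0n addSn.
  rewrite natrD natrM.
  have : y * beta <= k%:R * beta by rewrite ler_wpM2r // ltW.
  have : delta * k%:R <= delta * r%:R by rewrite ler_wpM2l // ltW.
  rewrite yE; lra.
(* Hence [2^h] is at most [expR 5] times the square root of [n], and [n / (4 * 2^h)] is at least of
   the order of that root. *)
have hk : (2 * k).+1%:R <= ln n%:R / 2 + 5 :> R.
  rewrite -natr1 natrM.
  have : y <= ln n%:R / 4 + 3 / 4.
    rewrite -(ler_pM2r b0) yE.
    have : delta * r%:R <= delta * (x + 3) by rewrite ler_wpM2l // ltW.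
    lra.
  lra.
set s := expR (ln n%:R / 2) : R; have s0 : 0 < s by rewrite expR_gt0.
have nE : n%:R = s ^+ 2 :> R.
  by rewrite expr2 -expRD -splitr lnK // posrE ltr0n.
have p0 : 0 < 1 - p by rewrite subr_gt0.
have hs : 4 * expR 5 / (1 - p) <= s.
  rewrite -(@ler_pXn2r _ 2) ?nnegrE -?nE // ?(ltW s0) //.
  by rewrite divr_ge0 ?mulr_ge0 ?expR_ge0 // ltW.
have h2 : 2 ^+ (2 * k).+1 <= s * expR 5.
  by rewrite -expRD (le_trans (exp2_le_expR _ _)) // ler_expR.
have z0 : 0 < 4 * 2 ^+ (2 * k).+1 :> R by rewrite mulr_gt0 ?exprn_gt0.
have big : 1 / (1 - p) <= n%:R / (4 * 2 ^+ (2 * k).+1).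
  rewrite ler_pdivlMr // nE expr2.
  apply: le_trans (_ : s * (4 * expR 5 / (1 - p)) <= _); last by rewrite ler_wpM2l // ltW.
  rewrite [leRHS](_ : _ = 1 / (1 - p) * (4 * (s * expR 5))); last by field; rewrite gt_eqF.
  by rewrite ler_wpM2l ?divr_ge0 ?(ltW p0) // ler_pM2l.
rewrite -[ltRHS]invrK ltf_pV2 ?posrE ?invr_gt0 //; lra.
Qed.

(** * The lower bound with its constants *)

Local Open Scope classical_set_scope.
Local Open Scope ring_scope.

Theorem theorem1p7 (R : realType) (alpha p c : R)
    (halpha : 0 < alpha < 1) (hp : 0 < p < 1) (hc : 0 < c <= 1 / 2) :
  exists2 delta0 : R, 0 < delta0 &
  forall (delta m : nat -> R)
    (hdelta : forall n, 0 < delta n < 1)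
    (m_Omega : exists2 a : R, 0 < a & \forall n \near \oo, a * n%:R <= m n)
    (m_O : exists2 b : R, 0 < b & \forall n \near \oo, m n <= b * n%:R ^+ 2),
  exists2 C : R, 0 < C &
  forall A : nat -> algorithm R,
    (\forall n \near \oo,
       forall (G : graph) (t : 'I_(nnodes G)),
         (nnodes G)%:R <= C * n%:R -> (nedges G)%:R <= C * m n ->
         ((1 - p)%:E <= success_prob alpha c (delta n) (A n) t)%E) ->
  exists2 K : R, 0 < K &
  \forall n \near \oo, delta n <= delta0 ->
    exists (U : graph) (t : 'I_(nnodes U)),
      [/\ (nnodes U)%:R <= C * n%:R,
          (nedges U)%:R <= C * m n
        & forall q : nat,
            ((1 - p)%:E <= success_within alpha c (delta n) (A n) t q)%E ->
            K * Num.min (m n) (n%:R / delta n * ln n%:R) <= q%:R].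
Proof.
have [a0 a1] := andP halpha; pose beta := (1 - alpha) ^+ 2.
have b0 : 0 < beta by rewrite exprn_gt0 // subr_gt0.
have b1 : beta < 1 by rewrite exprn_ilt1 ?subr_ge0 // ?ltW //; lra.
(* Up to [beta / 20], few enough fixed columns suffice for PageRank [delta n] that [k < r]. *)
exists (beta / 20) => [|delta m hdelta [a a_gt0 m_Omega] [b b_gt0 m_O]]; first by rewrite divr_gt0.
(* The edges number at most [20 * n * r + 2 <= 20 * m + 62 * n], the nodes at most
   [2 * n + 10 * r + 2] with [r <= b * n + 3]. *)
exists (20 + 62 / a + 10 * b + 34) => [|A _].
  by have := divr_gt0 (ltr0n R 62) a_gt0; lra.
(* The factor [beta / 20] from [x] times the [1 / 8] of [hard_instance]. *)
exists (beta / 160); first by rewrite divr_gt0.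
near=> n => hd.
have d0 : 0 < delta n by case/andP: (hdelta n).
have n0 : (0 < n)%N by near: n; exists 1%N.
have nR : 1 <= n%:R :> R by rewrite ler1n.
have am : a * n%:R <= m n by near: n.
have mb : m n <= b * n%:R ^+ 2 by near: n.
have big : (4 * expR 5 / (1 - p)) ^+ 2 <= n%:R by near: n; exact: nbhs_infty_ger.
have m0 : 0 <= m n by rewrite (le_trans _ am) // mulr_ge0 // ltW.
have ln0 : 0 <= ln (n%:R : R) by rewrite ln_ge0.
(* The first bound keeps [n * r], and so the edges, at most of order [m n]; the second keeps [2^h]
   at most of the order of the square root of [n]. *)
pose x := Num.min (m n / n%:R) (beta / 20 * ln n%:R / delta n).
have n_gt0 : 0 < n%:R :> R by rewrite ltr0n.
have x0 : 0 <= x.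
  rewrite le_min divr_ge0 //= divr_ge0 ?(ltW d0) // mulr_ge0 // divr_ge0 //.
  exact: ltW.
have xm : x * n%:R <= m n by rewrite -ler_pdivlMr // ge_min lexx.
have dx : delta n * x <= beta / 20 * ln n%:R.
  by rewrite mulrC -ler_pdivlMr // ge_min lexx orbT.
have p1 : p < 1 by case/andP: hp.
have hd' : 0 < delta n <= beta / 20 by rewrite d0.
have [k [r [k0 kr /andP[xr rx] hk hpk]]] := choose_parameters b0 hd' p1 x0 dx n0 big.
have hc' : 0 <= c <= 1 / 2 by case/andP: hc => /ltW -> ->.
have [U [t [Un Ue Uq]]] := hard_instance (A n) halpha hc' k0 (leq_ltn_trans (leq0n _) kr) kr hk hpk.
have krR : k%:R <= r%:R :> R by rewrite ler_nat ltnW.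
have rn : r%:R * n%:R <= m n + 3 * n%:R.
  by apply: le_trans (_ : (x + 3) * n%:R <= _); [rewrite ler_wpM2r|rewrite mulrDl lerD2r].
exists U, t; split.
- rewrite Un -addn1 !(natrM, natrD).
  have : r%:R <= b * n%:R + 3.
    by rewrite -(ler_pM2r n_gt0) (le_trans rn) //; lra.
  have : 0 <= 62 / a * n%:R by rewrite mulr_ge0 ?divr_ge0 ?ltW.
  lra.
- have am' : n%:R <= m n / a by rewrite ler_pdivlMr // mulrC.
  rewrite Ue !(natrM, natrD).
  have : r%:R <= r%:R * n%:R :> R by rewrite ler_peMr.
  have : k%:R * n%:R <= r%:R * n%:R :> R by rewrite ler_wpM2r.
  have : 0 <= b * m n by rewrite mulr_ge0 // ltW.
  have -> : (20 + 62 / a + 10 * b + 34) * m n = 62 * (m n / a) + 54 * m n + 10 * (b * m n) by ring.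
  lra.
move=> q /Uq/ltnW; rewrite -(ler_nat R) !natrM => nrq.
have : beta / 20 * Num.min (m n) (n%:R / delta n * ln n%:R) <= n%:R * r%:R.
  apply: le_trans (_ : n%:R * x <= _); last by rewrite ler_wpM2l.
  rewrite /x (minr_pMr _ _ (ltW n_gt0)) le_min; apply/andP; split.
    rewrite mulrCA divff ?gt_eqF // mulr1.
    apply: le_trans (_ : 1 * Num.min (m n) (n%:R / delta n * ln n%:R) <= _).
      rewrite ler_wpM2r //; last by lra.
      by rewrite le_min m0 mulr_ge0 // divr_ge0 // ltW.
    by rewrite mul1r ge_min lexx.
  apply: le_trans (_ : beta / 20 * (n%:R / delta n * ln n%:R) <= _).
    by rewrite ler_wpM2l ?ge_min ?lexx ?orbT // divr_ge0 // ltW.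
  by rewrite le_eqVlt; apply/orP; left; apply/eqP; ring.
lra.
Unshelve. all: by end_near.
Qed.
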